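(* Let $k$ be a field, and for $n\ge 2$ let $A_n=k[x_1,\ldots,x_n]_{(x_1,\ldots,x_n)}$ and $R_n=\mathcal T(A_n)$. Then for every $n\geq2$ the ring $R_n$ is not Gaussian. It is also not locally Prüfer and not arithmetical.
   Context: All rings are commutative with identity. For a nonzero local ring $(A,\mathfrak m)$ with residue field $\kappa=A/\mathfrak m$ and residue map $a\mapsto\bar a$, define the ring, with coordinatewise operations, $$\mathcal T(A)=\{(a,(c_i)_{i\in\mathbb N})\in A\times\kappa^{\mathbb N}: c_i=\bar a\text{ for all but finitely many }i\},\quad \mathbb N=\{1,2,\ldots\}.$$ For a polynomial $f\in B[T]$, $c_B(f)$ is the ideal of $B$ generated by its coefficients. A ring $B$ is Gaussian if $c_B(fg)=c_B(f)c_B(g)$ for all $f,g\in B[T]$. A ring is Prüfer if each of its finitely generated ideals containing a non-zero-divisor is projective (equivalently, invertible); it is locally Prüfer if its localization at every maximal ideal is Prüfer. A ring is arithmetical if in its localization at every maximal ideal the ideals are linearly ordered by inclusion. *)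

(* Defs.v *)
From HB Require Import structures.
From mathcomp Require Import all_boot all_order all_algebra.
From mathcomp Require Import boolp classical_sets functions cardinality.
From mathcomp Require Import mpoly ring.

Set Implicit Arguments.
Unset Strict Implicit.
Unset Printing Implicit Defensive.

Import GRing.Theory.

Local Open Scope ring_scope.
Local Open Scope quotient_scope.

Section Ideals.
Variable R : comNzRingType.
Implicit Types (I J m : {pred R}) (s : seq R).

(* The library's [idealr_closed] also requires [1 \notin I]: it is the notion
   of proper ideal. *)
Definition ideal_closed I : Prop :=
  0 \in I /\ forall a, {in I &, forall u v, a * u + v \in I}.

Definition maximal_ideal m : Prop :=
  idealr_closed m /\
  forall J, idealr_closed J -> {subset m <= J} -> {subset J <= m}.

Definition ideal_gen s : {pred R} :=
  fun x => `[< exists c : nat -> R, x = \sum_(i < size s) c i * s`_i >].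

Definition ideal_mul I J : {pred R} :=
  fun x => `[< exists2 s : seq (R * R),
                 {in s, forall p, p.1 \in I /\ p.2 \in J} &
                 x = \sum_(p <- s) p.1 * p.2 >].

Lemma ideal_genP s x :
  reflect (exists c : nat -> R, x = \sum_(i < size s) c i * s`_i)
          (x \in ideal_gen s).
Proof. exact: asboolP. Qed.

Lemma ideal_gen_submod s : submod_closed (ideal_gen s : {pred R^o}).
Proof.
split; first by apply/ideal_genP; exists (fun=> 0); rewrite big1// => i; rewrite mul0r.
move=> a u v /ideal_genP[c ->] /ideal_genP[d ->].
apply/ideal_genP; exists (fun i => a * c i + d i).
rewrite scaler_sumr -big_split/=; apply: eq_bigr => i _.
by rewrite mulrDl -mulrA.
Qed.

Lemma ideal_gen_closed s : ideal_closed (ideal_gen s).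
Proof. by have [? ?] := ideal_gen_submod s. Qed.

Lemma mem_ideal_gen s x : x \in s -> x \in ideal_gen s.
Proof.
move=> xs; apply/ideal_genP; exists (fun i => (i == index x s)%:R).
have h : (index x s < size s)%N by rewrite index_mem.
rewrite (bigD1 (Ordinal h))//= eqxx mul1r nth_index// big1 ?addr0//.
by move=> i /negPf; rewrite -val_eqE /= => ->; rewrite mul0r.
Qed.

Lemma maximal_ideal_prime m : maximal_ideal m -> prime_idealr_closed m.
Proof.
move=> [[m0 m1 mD] max] u v uv.
have mM a x : x \in m -> a * x \in m by move=> xm; rewrite -[_ * _]addr0 mD.
have mA x y : x \in m -> y \in m -> x + y \in m.
  by move=> xm ym; rewrite -[x]mul1r mD.
case: (boolP (u \in m)) => //= um.
pose J : {pred R} := fun x => `[< exists2 y, y \in m & exists a, x = a * u + y >].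
have uJ : u \in J by apply/asboolP; exists 0 => //; exists 1; rewrite mul1r addr0.
have [|J1] := boolP (1 \in J); last first.
  case/negP: um; apply: (max J) => //; last first.
    by move=> x xm; apply/asboolP; exists x => //; exists 0; rewrite mul0r add0r.
  split => //; first by apply/asboolP; exists 0 => //; exists 0; rewrite mul0r addr0.
  move=> a _ _ /asboolP[y ym [b ->]] /asboolP[z zm [c ->]].
  apply/asboolP; exists (a * y + z); first exact: mD.
  by exists (a * b + c); rewrite mulrDl mulrDr mulrA addrACA.
move=> /asboolP[y ym [a ua]].
rewrite -[v]mulr1 ua mulrDr; apply: mA; last exact: mM.
by rewrite mulrCA [v * u]mulrC; exact: mM.
Qed.

End Ideals.

Section Localization.
Variables (R : comNzRingType) (p : prime_idealr R).

Definition fraction := {x : R * R | x.2 \notin p}.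

Definition num (f : fraction) : R := (val f).1.
Definition den (f : fraction) : R := (val f).2.

Lemma denP f : den f \notin p. Proof. exact: (valP f). Qed.

Lemma one_notin : 1 \notin p. Proof. by rewrite idealr1. Qed.

Lemma mul_notin u v : u \notin p -> v \notin p -> u * v \notin p.
Proof. by move=> up vp; rewrite prime_idealrM negb_or up. Qed.

Definition mk_fraction a s (sp : s \notin p) : fraction :=
  exist (fun x : R * R => x.2 \notin p) (a, s) sp.

(* [R] may have zero divisors, whence the factor [u]. *)
Definition fraction_eq (f g : fraction) : bool :=
  `[< exists2 u, u \notin p & u * (num f * den g) = u * (num g * den f) >].

Lemma fraction_eq_equiv : equiv_class_of fraction_eq.
Proof.
split=> [f|f g|g f h].
- by apply/asboolP; exists 1; rewrite ?one_notin.
- by apply/asboolP/asboolP => -[u up e]; exists u.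
- move=> /asboolP[u up e] /asboolP[v vp e']; apply/asboolP.
  exists (u * v * den g); first by rewrite !mul_notin ?denP.
  transitivity (v * den h * (u * (num f * den g))); first by ring.
  rewrite e; transitivity (u * den f * (v * (num g * den h))); first by ring.
  by rewrite e'; ring.
Qed.

Canonical fraction_equiv := EquivRelPack fraction_eq_equiv.
Canonical fraction_enc := defaultEncModRel fraction_eq.

Definition localization := {eq_quot fraction_eq}.
HB.instance Definition _ : EqQuotient fraction fraction_eq localization :=
  EqQuotient.on localization.
HB.instance Definition _ := Choice.on localization.

Definition zerof := mk_fraction 0 one_notin.
Definition onef := mk_fraction 1 one_notin.
Definition addf f g := mk_fraction (num f * den g + num g * den f)
                                   (mul_notin (denP f) (denP g)).
Definition oppf f := mk_fraction (- num f) (denP f).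
Definition mulf f g := mk_fraction (num f * num g) (mul_notin (denP f) (denP g)).

Lemma num_mk a s (sp : s \notin p) : num (mk_fraction a sp) = a.
Proof. by []. Qed.
Lemma den_mk a s (sp : s \notin p) : den (mk_fraction a sp) = s.
Proof. by []. Qed.
Lemma num0 : num zerof = 0. Proof. by []. Qed.
Lemma den0 : den zerof = 1. Proof. by []. Qed.
Lemma num1 : num onef = 1. Proof. by []. Qed.
Lemma den1 : den onef = 1. Proof. by []. Qed.
Lemma numD f g : num (addf f g) = num f * den g + num g * den f.
Proof. by []. Qed.
Lemma denD f g : den (addf f g) = den f * den g. Proof. by []. Qed.
Lemma numN f : num (oppf f) = - num f. Proof. by []. Qed.
Lemma denN f : den (oppf f) = den f. Proof. by []. Qed.
Lemma numM f g : num (mulf f g) = num f * num g. Proof. by []. Qed.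
Lemma denM f g : den (mulf f g) = den f * den g. Proof. by []. Qed.

Definition fracE := (num_mk, den_mk, (num0, den0, num1, den1),
                     (numD, denD, numN, denN, numM, denM)).

Lemma pi_eqP (f g : fraction) :
  (\pi_localization f = \pi_localization g) <->
  exists2 u, u \notin p & u * (num f * den g) = u * (num g * den f).
Proof.
by split=> [/eqmodP/asboolP|/asboolP h] //; apply/eqmodP.
Qed.

Definition loc_zero : localization := lift_cst localization zerof.
Definition loc_one : localization := lift_cst localization onef.
Definition loc_add := lift_op2 localization addf.
Definition loc_opp := lift_op1 localization oppf.
Definition loc_mul := lift_op2 localization mulf.

Lemma reprE (f : fraction) :
  exists2 u, u \notin p & u * (num (repr (\pi_localization f)) * den f)
                          = u * (num f * den (repr (\pi_localization f))).
Proof. by apply/pi_eqP; rewrite reprK. Qed.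

Canonical pi_zero_morph := PiConst loc_zero.
Canonical pi_one_morph := PiConst loc_one.

Lemma pi_opp : {morph \pi : f / oppf f >-> loc_opp f}.
Proof.
move=> f; unlock loc_opp; apply/pi_eqP; have [u up e] := reprE f.
by exists u => //=; rewrite !fracE !mulNr !mulrN e.
Qed.
Canonical pi_opp_morph := PiMorph1 pi_opp.

Lemma pi_add : {morph \pi : f g / addf f g >-> loc_add f g}.
Proof.
move=> f g; unlock loc_add; apply/pi_eqP.
have [u up e] := reprE f; have [v vp e'] := reprE g.
set f' := repr (\pi f) in e *; set g' := repr (\pi g) in e' *.
exists (u * v); first exact: mul_notin.
rewrite !fracE.
transitivity (u * (num f * den f') * (v * den g * den g')
            + v * (num g * den g') * (u * den f * den f')); first by ring.
by rewrite -e -e'; ring.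
Qed.
Canonical pi_add_morph := PiMorph2 pi_add.

Lemma pi_mul : {morph \pi : f g / mulf f g >-> loc_mul f g}.
Proof.
move=> f g; unlock loc_mul; apply/pi_eqP.
have [u up e] := reprE f; have [v vp e'] := reprE g.
set f' := repr (\pi f) in e *; set g' := repr (\pi g) in e' *.
exists (u * v); first exact: mul_notin.
transitivity ((u * (num f * den f')) * (v * (num g * den g'))).
  by rewrite !fracE; ring.
by rewrite -e -e' !fracE; ring.
Qed.
Canonical pi_mul_morph := PiMorph2 pi_mul.

Ltac loc_law := move=> *;
  repeat (match goal with x : localization |- _ =>
    rewrite -[x]reprK; move: (repr x) => {x}? end);
  rewrite !piE; apply/pi_eqP; exists 1; rewrite ?one_notin// !fracE; ring.

Lemma loc_addA : associative loc_add. Proof. loc_law. Qed.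
Lemma loc_addC : commutative loc_add. Proof. loc_law. Qed.
Lemma loc_add0 : left_id loc_zero loc_add. Proof. loc_law. Qed.
Lemma loc_addN : left_inverse loc_zero loc_opp loc_add. Proof. loc_law. Qed.
Lemma loc_mulA : associative loc_mul. Proof. loc_law. Qed.
Lemma loc_mulC : commutative loc_mul. Proof. loc_law. Qed.
Lemma loc_mul1 : left_id loc_one loc_mul. Proof. loc_law. Qed.
Lemma loc_mulD : left_distributive loc_mul loc_add. Proof. loc_law. Qed.

HB.instance Definition _ :=
  GRing.isZmodule.Build localization loc_addA loc_addC loc_add0 loc_addN.

Lemma loc_one_neq0 : loc_one != 0.
Proof.
apply/eqP; rewrite -[0]/loc_zero !piE => /pi_eqP[u up].
rewrite !fracE !mulr1 mulr0 => u0.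
by move: up; rewrite u0 idealr0.
Qed.

HB.instance Definition _ := GRing.Zmodule_isComNzRing.Build localization
  loc_mulA loc_mulC loc_mul1 loc_mulD loc_one_neq0.

Definition loc_max : {pred localization} :=
  fun x => `[< exists2 f : fraction, num f \in p & x = \pi f >].

Lemma loc_maxP (f : fraction) : (\pi_localization f \in loc_max) = (num f \in p).
Proof.
apply/asboolP/idP => [[g gp /pi_eqP[u up e]]|fp]; last by exists f.
have : u * (num f * den g) \in p by rewrite e !prime_idealrM gp !orbT.
by rewrite !prime_idealrM (negPf up) (negPf (denP g)) /= orbF.
Qed.

Lemma loc_max_unit (x : localization) :
  x \notin loc_max -> exists y : localization, y * x = 1.
Proof.
rewrite -[x]reprK; move: (repr x) => {x} f; rewrite loc_maxP => fp.
exists (\pi_localization (mk_fraction (den f) fp)).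
rewrite -[_ * _]/(loc_mul _ _) -[1]/loc_one !piE; apply/pi_eqP.
exists 1; rewrite ?one_notin// !fracE; ring.
Qed.

Lemma loc_max_ideal : idealr_closed loc_max.
Proof.
split.
- by rewrite -[0]/loc_zero !piE loc_maxP idealr0.
- by rewrite -[1]/loc_one !piE loc_maxP idealr1.
move=> a u v; rewrite -[a]reprK -[u]reprK -[v]reprK.
move: (repr a) (repr u) (repr v) => {a u v} a u v.
rewrite -[_ * _ + _]/(loc_add (loc_mul _ _) _) !piE !loc_maxP => up vp.
rewrite !fracE rpredD//; last by rewrite mulrC idealMr.
by rewrite mulrC !idealMr.
Qed.

Lemma proper_sub_loc_max (J : {pred localization}) :
  idealr_closed J -> {subset J <= loc_max}.
Proof.
move=> [J0 J1 JD] x xJ; apply/negPn/negP => /loc_max_unit[y yx].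
by case/negP: J1; rewrite -yx -[y * x]addr0 JD.
Qed.

Lemma loc_max_maximal : maximal_ideal loc_max.
Proof. by split=> [|J /proper_sub_loc_max]; first exact: loc_max_ideal. Qed.

Lemma loc_max_unique (J : {pred localization}) : maximal_ideal J -> J =i loc_max.
Proof.
move=> [Ji Jmax] x; apply/idP/idP; first exact: proper_sub_loc_max.
by apply: Jmax (loc_max_ideal) _ x; exact: proper_sub_loc_max.
Qed.

End Localization.

HB.mixin Record isLocalRing A of GRing.ComNzRing A := {
  max_ideal : {pred A};
  max_ideal_maximal : maximal_ideal max_ideal;
  max_ideal_unique : forall J : {pred A}, maximal_ideal J -> J =i max_ideal
}.

#[short(type="localRingType")]
HB.structure Definition LocalRing := {A of GRing.ComNzRing A & isLocalRing A}.

HB.instance Definition _ (R : comNzRingType) (p : prime_idealr R) :=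
  isLocalRing.Build (localization p) (loc_max_maximal p) (@loc_max_unique R p).

Section TailRing.
Variable A : localRingType.

Definition local_ideal : {pred A} := max_ideal.
HB.instance Definition _ :=
  isIdealr.Build A local_ideal (max_ideal_maximal (s := A)).1.

Definition residue_field := {ideal_quot local_ideal}.
HB.instance Definition _ := GRing.ComNzRing.on residue_field.

Definition residue (a : A) : residue_field := \pi_{ideal_quot local_ideal} a.

Lemma residueB : {morph residue : a b / a - b}.
Proof. by move=> a b; rewrite /residue rmorphB. Qed.

Lemma residueM : {morph residue : a b / a * b}.
Proof. by move=> a b; rewrite /residue rmorphM. Qed.

Lemma residue1 : residue 1 = 1.
Proof. by rewrite /residue rmorph1. Qed.

(* The coordinates are indexed by [nat], thus from 0. *)
Definition residue_prod : Type := (A * (nat -> residue_field))%type.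
HB.instance Definition _ := GRing.ComNzRing.on residue_prod.

Definition eventually_residue : {pred residue_prod} :=
  fun x => `[< finite_set [set i | x.2 i <> residue x.1] >].

Lemma eventually_residue_subring : subring_closed eventually_residue.
Proof.
have finU (x y z : residue_prod) :
    (forall i, x.2 i = residue x.1 -> y.2 i = residue y.1 ->
               z.2 i = residue z.1) ->
    x \in eventually_residue -> y \in eventually_residue ->
    z \in eventually_residue.
  move=> xyz /asboolP xf /asboolP yf; apply/asboolP.
  apply: sub_finite_set (_ : finite_set (_ `|` _)%classic); last first.
    by rewrite finite_setU; split; [exact: xf|exact: yf].
  move=> i /= zi; apply: contrapT => /not_orP[/contrapT xi /contrapT yi].
  exact/zi/xyz.
split.
- apply/asboolP; rewrite (_ : [set _ | _] = set0)%classic ?finite_set0//.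
  by apply/seteqP; split=> // i; rewrite /= residue1.
- move=> x y; apply: finU => i; rewrite /= residueB => <- <-; reflexivity.
- move=> x y; apply: finU => i; rewrite /= residueM => <- <-; reflexivity.
Qed.

HB.instance Definition _ := GRing.isSubringClosed.Build residue_prod
  eventually_residue eventually_residue_subring.

Definition calT := {x : residue_prod | eventually_residue x}.

HB.instance Definition _ := SubChoice.on calT.
HB.instance Definition _ := [SubChoice_isSubComNzRing of calT by <:].

End TailRing.

Section RingProperties.
Variable B : comNzRingType.

Definition content (f : {poly B}) : {pred B} := ideal_gen (f : seq B).

Definition gaussian : Prop :=
  forall f g : {poly B}, content (f * g) =i ideal_mul (content f) (content g).

Definition projective (P : lmodType B) : Prop :=
  forall (M N : lmodType B) (g : {linear M -> N}) (h : {linear P -> N}),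
    (forall y, exists x, g x = y) ->
    exists l : {linear P -> M}, forall x, g (l x) = h x.

Definition fg_ideal (s : seq B) := {x : B^o | ideal_gen s x}.

HB.instance Definition _ s := SubChoice.on (fg_ideal s).
HB.instance Definition _ s := GRing.SubChoice_isSubLmodule.Build B B^o
  (ideal_gen s) (fg_ideal s) (GRing.submod_closed_semi (ideal_gen_submod s)).

(* [GRing.lreg] expresses that multiplication by [r] is injective. *)
Definition prufer : Prop :=
  forall s : seq B,
    (exists2 r, r \in ideal_gen s & GRing.lreg r) -> projective (fg_ideal s).

Definition ideals_chain : Prop :=
  forall I J : {pred B}, ideal_closed I -> ideal_closed J ->
    {subset I <= J} \/ {subset J <= I}.

End RingProperties.

(* Maximal ideals are prime, by [maximal_ideal_prime]. *)
Definition locally (P : comNzRingType -> Prop) (B : comNzRingType) : Prop :=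
  forall m : prime_idealr B, maximal_ideal m -> P (localization m).

Definition locally_prufer := locally prufer.

Definition arithmetical := locally ideals_chain.

Section PolynomialLocalRing.
Variables (k : fieldType) (n : nat).

Definition vars : seq {mpoly k[n]} := [seq 'X_i | i : 'I_n].

Definition origin_ideal : {pred {mpoly k[n]}} := ideal_gen vars.

Lemma origin_idealP (f : {mpoly k[n]}) : (f \in origin_ideal) = (f@_0%MM == 0).
Proof.
have coef0M (g h : {mpoly k[n]}) : (g * h)@_0%MM = g@_0%MM * h@_0%MM.
  exact: rmorphM.
have clM a g : g \in origin_ideal -> a * g \in origin_ideal.
  have [I0 ID] := ideal_gen_closed vars.
  by move=> gI; rewrite -[_ * _]addr0; apply: ID.
apply/idP/eqP => [/ideal_genP[c ->]|f0].
  rewrite raddf_sum big1// => i _ /=; rewrite coef0M.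
  have : vars`_i \in vars by exact: mem_nth.
  by move=> /mapP[j _ ->]; rewrite mcoeffX mnm1_eq0 mulr0.
rewrite (mpolyE f) big_seq.
apply: (big_ind (fun g => g \in origin_ideal)) => [|g h gI hI|m].
- exact: (ideal_gen_closed _).1.
- by rewrite -[g]mul1r; apply: (ideal_gen_closed _).2.
rewrite mcoeff_msupp => fm; rewrite -mul_mpolyC; apply: (clM).
have m0 : m != 0%MM by apply: contraNneq fm => ->; rewrite f0.
have [i mi|m00] := pickP (fun i => m i != 0%N); last first.
  by case/eqP: m0; apply/mnmP => i; have /negbFE/eqP := m00 i; rewrite mnm0E.
rewrite -(@submK _ U_(i) m) ?lep1mP// mpolyXD; apply: (clM).
by apply: mem_ideal_gen; apply: map_f; rewrite mem_enum.
Qed.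

Lemma origin_ideal_proper : idealr_closed origin_ideal.
Proof.
have [I0 ID] := ideal_gen_closed vars.
by split=> //; rewrite origin_idealP mcoeff1 eqxx oner_eq0.
Qed.

Lemma origin_ideal_prime : prime_idealr_closed origin_ideal.
Proof.
by move=> f g; rewrite !origin_idealP rmorphM mulf_eq0.
Qed.

HB.instance Definition _ :=
  isIdealr.Build {mpoly k[n]} origin_ideal origin_ideal_proper.
HB.instance Definition _ :=
  isPrimeIdealrClosed.Build {mpoly k[n]} origin_ideal origin_ideal_prime.

Definition polyloc := localization origin_ideal.

HB.instance Definition _ := LocalRing.on polyloc.

End PolynomialLocalRing.

(* Main.v *)
(** The polynomial variables [x = X_0], [y = X_1] satisfy: if
    [c x y = a x^2 + b y^2] then [c] is in the maximal ideal.  This property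
    passes to localizations, hence to [A = polyloc k n], then to the lifts
    [(x, 0)], [(y, 0)] in [R = calT A], and to the localization of [R] at
    the maximal ideal lying over that of [A].
    - If [R] were Gaussian, the product [(x + y T) (x - y T) = x^2 - y^2 T^2]
      would put [x y] in the ideal [(x^2, y^2)].
    - At that maximal ideal neither of [x], [y] divides the other.
    - The ideal [(x, y)] of that localization contains the regular element
      [x]; a linear section [l] of [(a, b) |-> a x + b y] would satisfy
      [y l(x) = x l(y)], which forces [l(x)] to have coordinates in the maximal
      ideal and contradicts [x = l_1(x) x + l_2(x) y]. *)
Require Import Defs.
From HB Require Import structures.
From mathcomp Require Import all_boot all_algebra.
From mathcomp Require Import boolp classical_sets cardinality.
From mathcomp Require Import mpoly ring.

Set Implicit Arguments.
Unset Strict Implicit.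
Unset Printing Implicit Defensive.

Import GRing.Theory.

Local Open Scope ring_scope.
Local Open Scope quotient_scope.

Section QuadraticIndependence.
Variable B : comNzRingType.
Implicit Types (m : {pred B}) (x y : B).

Definition quad_indep m x y : Prop :=
  forall a b c, c * (x * y) = a * x ^+ 2 + b * y ^+ 2 -> c \in m.

Lemma quad_indepC m x y : quad_indep m x y -> quad_indep m y x.
Proof. by move=> h a b c e; apply: (h b a); rewrite [x * y]mulrC e addrC. Qed.

(** Multiplying the relation by [x] gives [b * (x * y) = a * x ^+ 2]. *)
Lemma quad_indep_coef m x y a b :
  quad_indep m x y -> a * x = b * y -> b \in m.
Proof. by move=> h e; apply: (h a 0); rewrite expr2 (mulrA a) e; ring. Qed.

Lemma coef_content (f : {poly B}) i : f`_i \in content f.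
Proof.
case: (ltnP i (size f)) => [ltif|leif]; first exact/mem_ideal_gen/mem_nth.
by rewrite nth_default//; exact: (ideal_gen_closed _).1.
Qed.

Lemma not_gaussian m x y : 1 \notin m -> quad_indep m x y -> ~ gaussian B.
Proof.
move=> m1 h G.
pose f : {poly B} := x%:P + y%:P * 'X; pose g : {poly B} := x%:P - y%:P * 'X.
have fgE : f * g = (x ^+ 2)%:P - (y ^+ 2)%:P * 'X^2.
  by rewrite /f /g !polyCM; ring.
have f0 : x \in content f.
  by have := coef_content f 0; rewrite coefD coefC coefCM coefX mulr0 addr0.
have g1 : - y \in content g.
  by have := coef_content g 1; rewrite coefB coefC coefCM coefX mulr1 sub0r.
have : x * - y \in content (f * g).
  rewrite G; apply/asboolP; exists [:: (x, - y)]; last by rewrite big_seq1.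
  by move=> p; rewrite inE => /eqP ->.
case/ideal_genP => c e.
suff [a [b e']] : exists a b, x * - y = a * x ^+ 2 + b * y ^+ 2.
  case/negP: m1; apply: (h (- a) (- b)).
  by rewrite mul1r !mulNr -opprD -e'; ring.
rewrite e; apply: (big_ind (fun z => exists a b, z = a * x ^+ 2 + b * y ^+ 2)).
- by exists 0, 0; rewrite !mul0r addr0.
- move=> _ _ [a [b ->]] [a' [b' ->]]; exists (a + a'), (b + b'); ring.
(* [f * g] has coefficient [x ^+ 2] in degree 0, [- y ^+ 2] in degree 2, and zero in all other
   degrees. *)
case=> i /= _ _; exists (c i * (i == 0%N)%:R), (- (c i * (i == 2)%:R)).
rewrite fgE coefB coefC coefCM coefXn; case: eqP => _ /=; ring.
Qed.

Lemma not_ideals_chain m x y :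
  1 \notin m -> quad_indep m x y -> ~ ideals_chain B.
Proof.
move=> m1 h chain.
(* The inclusion would give [v = c * u], and then the coefficient 1 of [v] would lie in [m]. *)
have dvd u v : quad_indep m u v ->
    ~ {subset ideal_gen [:: v] <= ideal_gen [:: u]}.
  move=> huv sub; case/ideal_genP: (sub v (mem_ideal_gen (mem_head _ _))) => c.
  rewrite big_ord1 /= => e; case/negP: m1.
  by apply: (quad_indep_coef (a := c 0) huv); rewrite mul1r.
have [] := chain _ _ (ideal_gen_closed [:: x]) (ideal_gen_closed [:: y]).
  exact/dvd/quad_indepC.
exact: dvd.
Qed.

Section TwoGenerators.
Variables x y : B.

Definition combination (u : (B^o * B^o)%type) : B^o := u.1 * x + u.2 * y.

Lemma combination_gen u : ideal_gen [:: x; y] (combination u).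
Proof.
apply/ideal_genP; exists (fun i => if i is 0 then u.1 else u.2).
by rewrite big_ord_recl big_ord1.
Qed.

Definition combination_ideal u : fg_ideal [:: x; y] :=
  Sub (combination u) (combination_gen u).

Lemma combination_ideal_linear : linear combination_ideal.
Proof.
move=> a u v; apply: val_inj; rewrite linearP /= /combination /=.
by rewrite /GRing.scale /=; ring.
Qed.

HB.instance Definition _ :=
  GRing.isLinear.Build B (B^o * B^o)%type (fg_ideal [:: x; y]) _
    combination_ideal combination_ideal_linear.

Lemma combination_ideal_surj z : exists u, combination_ideal u = z.
Proof.
have /ideal_genP[c] := valP z; rewrite big_ord_recl big_ord1 => e.
by exists (c 0, c 1); apply: val_inj; rewrite e.
Qed.

End TwoGenerators.

Lemma not_prufer m x y :
  idealr_closed m -> quad_indep m x y -> GRing.lreg x -> ~ prufer B.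
Proof.
move=> [_ m1 mD] h xreg P; set s := [:: x; y].
have xs : x \in ideal_gen s by apply: mem_ideal_gen; rewrite mem_head.
have ys : y \in ideal_gen s by apply: mem_ideal_gen; rewrite !inE eqxx orbT.
(* Projectivity lifts the identity of [(x, y)] through the surjection from the free module of rank
   2. *)
have [|l lK] := P s _ _ _ (combination_ideal x y) idfun
                  (@combination_ideal_surj x y); first by exists x.
pose X : fg_ideal s := Sub (x : B^o) xs.
pose Y : fg_ideal s := Sub (y : B^o) ys.
have XY : y *: X = x *: Y.
  by apply: val_inj; rewrite !linearZ /= /GRing.scale /= mulrC.
have lXY : y *: l X = x *: l Y by rewrite -!linearZ XY.
have e1 : (l Y).1 * x = (l X).1 * y.
  by rewrite [LHS]mulrC [RHS]mulrC; exact: esym (congr1 fst lXY).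
have l1 : (l X).1 \in m := quad_indep_coef h e1.
(* Since [l] is a section, the coordinates of [l X] combine to [x]. This puts [1 - (l X).1] in [m],
   next to [(l X).1]. *)
have e2 : (l X).2 * y = (1 - (l X).1) * x.
  have e : (l X).1 * x + (l X).2 * y = x := congr1 val (lK X).
  by apply/esym/eqP; rewrite mulrBl mul1r subr_eq addrC e.
have := quad_indep_coef (quad_indepC h) e2 => l2.
by case/negP: m1; rewrite -[1](subrK (l X).1) -[1 - _]mul1r mD.
Qed.

End QuadraticIndependence.

Section LocalizationMap.
Variables (R : comNzRingType) (p : prime_idealr R).

Definition loc_map (a : R) : localization p :=
  \pi_(localization p) (mk_fraction a (one_notin p)).

Lemma loc_quad_indep x y :
  quad_indep p x y -> quad_indep (loc_max (p := p)) (loc_map x) (loc_map y).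
Proof.
move=> h a b c; rewrite -[a]reprK -[b]reprK -[c]reprK.
move: (repr a) (repr b) (repr c) => {a b c} a b c.
rewrite !expr2 -[_ + _]/(loc_add (loc_mul _ (loc_mul _ _))
                                    (loc_mul _ (loc_mul _ _))).
rewrite -[_ * _]/(loc_mul _ (loc_mul _ _)) /loc_map !piE => /pi_eqP[u up].
rewrite !fracE !mulr1 => e; rewrite loc_maxP.
(* Clearing denominators gives a relation in [R]. Its coefficient lies in the prime [p], while all
   factors but [num c] lie outside. *)
have : u * den a * den b * num c \in p.
  apply: (h (u * den c * num a * den b) (u * den c * num b * den a)).
  transitivity (u * (num c * (x * y) * (den a * den b))); first by ring.
  by rewrite e; ring.
by rewrite !prime_idealrM (negPf up) !(negPf (denP _)).
Qed.

(** The annihilator of [x] only has to vanish in the localization. Regularity in [R] would be too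
    strong: in [calT A] a lift [(x, 0)] kills every [(0, c)]. *)
Lemma loc_map_lreg x :
  (forall a, x * a = 0 -> exists2 u, u \notin p & u * a = 0) ->
  GRing.lreg (loc_map x).
Proof.
move=> h a b /=; rewrite -[a]reprK -[b]reprK.
move: (repr a) (repr b) => {a b} a b.
rewrite -![_ * _]/(loc_mul _ _) /loc_map !piE => /pi_eqP[u up].
rewrite !fracE !mul1r => e; apply/pi_eqP.
have [|v vp ve] := h (u * (num a * den b - num b * den a)).
  rewrite mulrBr mulrBr; apply/eqP; rewrite subr_eq0; apply/eqP.
  by rewrite mulrCA mulrA -mulrA (mulrA x) e; ring.
exists (v * u); first exact: mul_notin.
by apply/eqP; rewrite -subr_eq0 -mulrBr -mulrA ve.
Qed.

End LocalizationMap.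

Section TailIdeal.
Variable A : localRingType.
Implicit Types r : calT A.

Let R := calT A.

Lemma calT_eq r r' :
  (val r).1 = (val r').1 -> (val r).2 = (val r').2 -> r = r'.
Proof.
move=> e1 e2; apply: val_inj.
by case: (val r) (val r') e1 e2 => [a c] [a' c'] /= -> ->.
Qed.

Lemma residue0 : residue (0 : A) = 0.
Proof. by rewrite /residue rmorph0. Qed.

Definition tail_ideal : {pred R} := fun r => (val r).1 \in local_ideal (A := A).

Lemma tail_ideal_proper : idealr_closed tail_ideal.
Proof.
have [? ? mD] := (max_ideal_maximal (s := A)).1.
split=> // a u v um vm; exact: mD.
Qed.

Lemma tail_ideal_prime : prime_idealr_closed tail_ideal.
Proof.
by move=> u v uv; apply: (maximal_ideal_prime (max_ideal_maximal (s := A))).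
Qed.

HB.instance Definition _ := isIdealr.Build R tail_ideal tail_ideal_proper.
HB.instance Definition _ :=
  isPrimeIdealrClosed.Build R tail_ideal tail_ideal_prime.

Lemma constant_tail_mem (a : A) :
  eventually_residue ((a, fun=> residue a) : residue_prod A).
Proof.
apply/asboolP; rewrite (_ : [set _ | _] = set0)%classic ?finite_set0//.
by apply/seteqP; split.
Qed.

(** For [a] in the maximal ideal of [A] this is the lift [(a, 0)]. *)
Definition constant_tail (a : A) : R := Sub _ (constant_tail_mem a).

(** The first projection carries [J] to a proper ideal [I] containing the maximal ideal of [A], so
    maximality in [A] bounds [J]. *)
Lemma tail_ideal_maximal : maximal_ideal tail_ideal.
Proof.
split=> [|J [J0 J1 JD] mJ r rJ]; first exact: tail_ideal_proper.
pose I : {pred A} := fun a => `[< exists2 r : R, r \in J & (val r).1 = a >].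
have [[m0 _ _] mmax] := max_ideal_maximal (s := A).
apply: (mmax I); last by apply/asboolP; exists r.
- split; first by apply/asboolP; exists 0.
  + apply/negP => /asboolP[u uJ u1]; case/negP: J1.
    (* [1 - u] has first coordinate 0, hence lies in [tail_ideal] and so in [J]. *)
    rewrite -[1](subrK u) addrC -[u]mul1r JD //; apply: mJ.
    by rewrite mul1r /in_mem /= /tail_ideal /= u1 subrr.
  + move=> a _ _ /asboolP[u uJ <-] /asboolP[v vJ <-].
    by apply/asboolP; exists (constant_tail a * u + v) => //; exact: JD.
- move=> a am; apply/asboolP; exists (constant_tail a) => //.
  exact: mJ.
Qed.

Lemma constant_tail_quad_indep (x y : A) :
  quad_indep (local_ideal (A := A)) x y ->
  quad_indep tail_ideal (constant_tail x) (constant_tail y).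
Proof.
move=> h a b c /(congr1 (fun r : R => (val r).1)) /= e.
exact: (h (val a).1 (val b).1).
Qed.

(* [(0, c)] with [c] of finite support [S] is killed by [(1, 1 - 1_S)]. *)
Lemma constant_tail_torsion (x : A) (r : R) :
  GRing.lreg x -> constant_tail x * r = 0 ->
  exists2 u, u \notin tail_ideal & u * r = 0.
Proof.
move=> xreg /(congr1 (fun r : R => (val r).1)) /= e.
have r0 : (val r).1 = 0 by apply: xreg; rewrite mulr0.
pose d i : residue_field A := if (val r).2 i == 0 then 1 else 0.
have dT : eventually_residue ((1, d) : residue_prod A).
  apply/asboolP; have /asboolP := valP r; apply: sub_finite_set => i /=.
  by rewrite r0 residue1 /d residue0; case: eqP.
exists (Sub _ dT : R).
  by case: (max_ideal_maximal (s := A)) => -[].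
apply: calT_eq; first by rewrite /= r0 mulr0.
apply/funext => i /=; rewrite -[LHS]/(d i * (val r).2 i) /d.
by case: eqP => [->|]; rewrite ?mulr0 ?mul0r.
Qed.

End TailIdeal.

(** At the squarefree monomial [U_(i) + U_(j)] multiples of the two squares have coefficient zero,
    and the left side has the constant coefficient of [c]. *)
Lemma mpolyX_quad_indep (k : fieldType) (n : nat) (i j : 'I_n) :
  i != j ->
  quad_indep (origin_ideal (k := k) (n := n)) ('X_i : {mpoly k[n]}) 'X_j.
Proof.
move=> ij a b c /(congr1 (mcoeff (U_(i) + U_(j)))).
have sq0 (f : {mpoly k[n]}) (l : 'I_n) : (f * 'X_l ^+ 2)@_(U_(i) + U_(j)) = 0.
  rewrite mpolyXn mcoeffM big1// => -[u v] /= /eqP e; rewrite mcoeffX.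
  case: eqP => [vE|]; last by rewrite mulr0.
  (* The exponent of ['X_l] is at least 2 in [u + v] but at most 1 in [U_(i) + U_(j)], as
     [i != j]. *)
  have := congr1 (fun w : 'X_{1..n} => w l) e.
  rewrite !mnmE -vE mulmnE !mnmE eqxx.
  move: (bmnm u l) ij => w ij e'; exfalso; move: ij e'.
  by case: (i =P l) => [->|_]; case: (j =P l) => [->|_];
    rewrite ?eqxx// mul1n addn2.
rewrite -mpolyXD -{1}[(U_(i) + U_(j))%MM]addm0 mcoeffMX mcoeffD !sq0 addr0.
by move=> c0; rewrite origin_idealP c0.
Qed.

Theorem proposition8p2 (k : fieldType) (n : nat) (hn : (2 <= n)%N) :
  [/\ ~ gaussian (calT (polyloc k n)),
      ~ locally_prufer (calT (polyloc k n)) &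
      ~ arithmetical (calT (polyloc k n))].
Proof.
pose i : 'I_n := Ordinal (ltnW hn); pose j : 'I_n := Ordinal hn.
pose p : prime_idealr {mpoly k[n]} := origin_ideal (k := k) (n := n).
pose A : localRingType := polyloc k n.
pose x : A := loc_map p 'X_i; pose y : A := loc_map p 'X_j.
have hA : quad_indep (local_ideal (A := A)) x y.
  exact/loc_quad_indep/mpolyX_quad_indep.
have xreg : GRing.lreg x.
  (* In the domain [{mpoly k[n]}] it suffices that ['X_i] is nonzero, which its coefficient at
     [U_(i)] shows. *)
  apply: loc_map_lreg => a /eqP; rewrite mulf_eq0 => /orP[/eqP x0|/eqP ->].
    have := mcoeffXU k i i; rewrite x0 mcoeff0 eqxx => /esym/eqP.
    by rewrite oner_eq0.
  by exists 1; rewrite ?one_notin ?mulr0.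
pose q : prime_idealr (calT A) := tail_ideal (A := A).
have hR : quad_indep q (constant_tail x) (constant_tail y).
  exact: constant_tail_quad_indep.
have hq := loc_quad_indep hR.
have qI := loc_max_ideal q; have [_ q1 _] := qI.
split.
- by apply: not_gaussian hR; rewrite idealr1.
- move=> /(_ q (tail_ideal_maximal A)); apply: not_prufer hq _ => //.
  by apply: loc_map_lreg => r; exact: constant_tail_torsion.
- by move=> /(_ q (tail_ideal_maximal A)); apply: not_ideals_chain hq.
Qed.
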